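(* Let $\mathbb{L}$ be a field and let $S=(\emptyset,\mathcal{F}_\lhd,k,g)$ be a monic triangular system that is dense in $\mathbb{L}[T_1,\dots,T_r]$. Set $R:=\mathbb{L}[T_1,\dots,T_r]/\langle\mathcal{F}_\lhd\rangle$. Then $\mathbb{L}\subseteq R$ is an integral extension, and with the minimal polynomial $p_g\in\mathbb{L}[X]$ of the residue class $\overline{g}\in R$ we have $$V(S)\neq\emptyset\quad\Longleftrightarrow\quad p_g\in\mathbb{L}[X]\text{ is not a monomial}.$$
   Context: Variables are ordered $T_1>\dots>T_r$. For a non-constant polynomial $f$ let $k(f)$ be the smallest index of a variable occurring in $f$, and let $\mathrm{LC}_{k(f)}(f)\in\mathbb{L}[T_{k(f)+1},\dots,T_r]$ be the leading coefficient of $f$ as a polynomial in $T_{k(f)}$. A tuple $(\emptyset,\mathcal{F}_\lhd,k,g)$ with $\mathcal{F}_\lhd=\{f_1,\dots,f_s\}\subseteq\mathbb{L}[T_1,\dots,T_r]$ finite, $0\le k\le r$, $g\in\mathbb{L}[T_1,\dots,T_r]$ is a *triangular system* if (after ordering) $k(f_1)<\dots<k(f_s)$, $\mathrm{LC}_{k(f)}(f)\mid g$ for all $f\in\mathcal{F}_\lhd$, and $\{k(f): f\in\mathcal{F}_\lhd\}\subseteq\{1,\dots,k\}$. It is *dense* in $\mathbb{L}[T_1,\dots,T_r]$ if $\{k(f): f\in\mathcal{F}_\lhd\}=\{1,\dots,r\}$, and *monic* if $\mathrm{LC}_{k(f)}(f)=1$ for all $f\in\mathcal{F}_\lhd$.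 Its solution set is $V(S):=V(\mathcal{F}_\lhd)\setminus V(g)\subseteq\overline{\mathbb{L}}^r$. The minimal polynomial of $\overline g\in R$ is the monic polynomial of least degree in $\mathbb{L}[X]$ annihilating $\overline g$; ''monomial'' means $X^n$ for some $n\in\mathbb{Z}_{\ge0}$. *)

(* Defs.v *)
From HB Require Import structures.
From mathcomp Require Import all_boot all_order all_algebra.
From mathcomp Require Import generic_quotient ring_quotient finmap.
From mathcomp Require Import boolp mpoly.

Set Implicit Arguments.
Unset Strict Implicit.
Unset Printing Implicit Defensive.

Import GRing.Theory.

Local Open Scope ring_scope.
Local Open Scope quotient_scope.

(* The variable T_i of L[T_1, ..., T_r] is 'X_j with j : 'I_r of value i - 1;
   variable indices of type nat are the 1-based ones. *)

Definition occurs_in (L : fieldType) (r : nat) (f : {mpoly L[r]})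
    (j : 'I_r) : bool :=
  has (fun m : 'X_{1..r} => m j != 0%N) (msupp f).

(* The smallest i with T_i occurring in f (r + 1 if f is constant). *)
Definition kidx (L : fieldType) (r : nat) (f : {mpoly L[r]}) : nat :=
  (find (occurs_in f) (enum 'I_r)).+1.

(* f as a polynomial in T_i, with coefficients in the other variables. *)
Definition upoly (L : fieldType) (r : nat) (i : nat) (f : {mpoly L[r]}) :
    {poly {mpoly L[r]}} :=
  mmap (fun c : L => c%:MP%:P)
       (fun j : 'I_r => if j.+1 == i then 'X else ('X_j)%:P) f.

Definition LC (L : fieldType) (r : nat) (i : nat) (f : {mpoly L[r]}) :
    {mpoly L[r]} :=
  lead_coef (upoly i f).

Definition nonconstant (L : fieldType) (r : nat) (f : {mpoly L[r]}) : Prop :=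
  forall c : L, f <> c%:MP.

(* The tuple (0, F, k, g): its first component is always empty and is left
   out. *)
Record triangular_system (L : fieldType) (r : nat) := TriangularSystem {
  tsF : {fset {mpoly L[r]}};
  tsk : nat;
  tsg : {mpoly L[r]};
  _ : (tsk <= r)%N;
  _ : forall f, f \in tsF -> nonconstant f;
  _ : exists2 fs : seq {mpoly L[r]},
        fs =i tsF & sorted ltn [seq kidx f | f <- fs];
  _ : forall f, f \in tsF -> exists q, tsg = q * LC (kidx f) f;
  _ : forall f, f \in tsF -> (1 <= kidx f <= tsk)%N
}.

Definition dense_system (L : fieldType) (r : nat)
    (S : triangular_system L r) : Prop :=
  forall i : nat, (exists2 f, f \in tsF S & kidx f = i) <-> (1 <= i <= r)%N.

Definition monic_system (L : fieldType) (r : nat)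
    (S : triangular_system L r) : Prop :=
  forall f, f \in tsF S -> LC (kidx f) f = 1.

(* The points of V(S), with coordinates in an extension E of L along iota. *)
Definition solution (L E : fieldType) (iota : {rmorphism L -> E}) (r : nat)
    (S : triangular_system L r) (x : 'I_r -> E) : Prop :=
  (forall f, f \in tsF S -> (map_mpoly iota f).@[x] = 0) /\
  (map_mpoly iota (tsg S)).@[x] <> 0.

Definition algebraic_closure (L : fieldType) (E : closedFieldType)
    (iota : {rmorphism L -> E}) : Prop :=
  forall z : E, algebraicOver iota z.

Definition gen_ideal (L : fieldType) (r : nat) (F : {fset {mpoly L[r]}}) :
    {pred {mpoly L[r]}} :=
  fun p => `[< exists q : {mpoly L[r]} -> {mpoly L[r]},
                 p = \sum_(f <- F) q f * f >].

Lemma gen_ideal_zmod_closed (L : fieldType) (r : nat)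
  (F : {fset {mpoly L[r]}}) : zmod_closed (gen_ideal F).
Proof.
split=> [|p1 p2 /asboolP[q1 ->] /asboolP[q2 ->]]; apply/asboolP.
  by exists (fun _ => 0); rewrite big1 // => f _; rewrite mul0r.
exists (fun f => q1 f - q2 f); rewrite -sumrB.
by apply: eq_bigr => f _; rewrite mulrBl.
Qed.

HB.instance Definition _ (L : fieldType) (r : nat) (F : {fset {mpoly L[r]}}) :=
  GRing.isZmodClosed.Build {mpoly L[r]} (gen_ideal F)
    (gen_ideal_zmod_closed F).

Lemma gen_idealMr (L : fieldType) (r : nat) (F : {fset {mpoly L[r]}})
  (a p : {mpoly L[r]}) : p \in gen_ideal F -> a * p \in gen_ideal F.
Proof.
move=> /asboolP[q ->]; apply/asboolP; exists (fun f => a * q f).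
by rewrite mulr_sumr; apply: eq_bigr => f _; rewrite mulrA.
Qed.

(* L[T_1, ..., T_r] / <F>. The library makes {ideal_quot I} a ring only for a proper
   ideal I; since <F> may be the unit ideal, the multiplication is put on
   {ideal_quot gen_ideal F} here, as a possibly zero ring. *)
Definition quot_ring (L : fieldType) (r : nat) (F : {fset {mpoly L[r]}}) :
    Type :=
  {ideal_quot gen_ideal F}.

HB.instance Definition _ (L : fieldType) (r : nat) (F : {fset {mpoly L[r]}}) :=
  GRing.Zmodule.on (quot_ring F).

Definition quot_class (L : fieldType) (r : nat) (F : {fset {mpoly L[r]}})
    (p : {mpoly L[r]}) : quot_ring F :=
  \pi_({ideal_quot gen_ideal F}) p.

Definition quot_one (L : fieldType) (r : nat) (F : {fset {mpoly L[r]}}) :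
    quot_ring F :=
  quot_class F 1.

Definition quot_mul (L : fieldType) (r : nat) (F : {fset {mpoly L[r]}})
    (x y : quot_ring F) : quot_ring F :=
  quot_class F (repr (x : {ideal_quot gen_ideal F}) * repr (y : {ideal_quot gen_ideal F})).

Lemma quot_class_eq (L : fieldType) (r : nat) (F : {fset {mpoly L[r]}})
  (p q : {mpoly L[r]}) :
  p - q \in gen_ideal F <-> quot_class F p = quot_class F q.
Proof. by rewrite Quotient.idealrBE; split=> /eqP. Qed.

Lemma quot_class_surj (L : fieldType) (r : nat) (F : {fset {mpoly L[r]}})
  (x : quot_ring F) : exists p, x = quot_class F p.
Proof. by exists (repr (x : {ideal_quot gen_ideal F})); rewrite /quot_class reprK. Qed.

Lemma quot_classB (L : fieldType) (r : nat) (F : {fset {mpoly L[r]}}) :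
  {morph quot_class F : p q / p - q}.
Proof. exact: (raddfB (\pi_({ideal_quot gen_ideal F}))). Qed.

Lemma quot_classD (L : fieldType) (r : nat) (F : {fset {mpoly L[r]}}) :
  {morph quot_class F : p q / p + q}.
Proof. exact: (raddfD (\pi_({ideal_quot gen_ideal F}))). Qed.

Lemma quot_classM (L : fieldType) (r : nat) (F : {fset {mpoly L[r]}})
  (p q : {mpoly L[r]}) :
  quot_class F (p * q) = quot_mul (quot_class F p) (quot_class F q).
Proof.
have repI u : u - repr (\pi_({ideal_quot gen_ideal F}) u) \in gen_ideal F.
  by apply/quot_class_eq; rewrite /quot_class reprK.
apply/quot_class_eq; set p' := repr _; set q' := repr _.
rewrite [p * q - _](_ : _ = q * (p - p') + p' * (q - q')).
  by rewrite rpredD // gen_idealMr //; apply: repI.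
by rewrite !mulrBr (mulrC q) (mulrC q) addrA subrK.
Qed.

Lemma quot_mulA (L : fieldType) (r : nat) (F : {fset {mpoly L[r]}}) :
  associative (@quot_mul L r F).
Proof.
move=> x y z; have [[p ->] [q ->] [s ->]] :=
  And3 (quot_class_surj x) (quot_class_surj y) (quot_class_surj z).
by rewrite -!quot_classM mulrA.
Qed.

Lemma quot_mulC (L : fieldType) (r : nat) (F : {fset {mpoly L[r]}}) :
  commutative (@quot_mul L r F).
Proof.
move=> x y; have [[p ->] [q ->]] :=
  conj (quot_class_surj x) (quot_class_surj y).
by rewrite -!quot_classM mulrC.
Qed.

Lemma quot_mul1 (L : fieldType) (r : nat) (F : {fset {mpoly L[r]}}) :
  left_id (quot_one F) (@quot_mul L r F).
Proof.
by move=> x; have [p ->] := quot_class_surj x; rewrite -quot_classM mul1r.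
Qed.

Lemma quot_mulDl (L : fieldType) (r : nat) (F : {fset {mpoly L[r]}}) :
  left_distributive (@quot_mul L r F) +%R.
Proof.
move=> x y z; have [[p ->] [q ->] [s ->]] :=
  And3 (quot_class_surj x) (quot_class_surj y) (quot_class_surj z).
by rewrite -quot_classD -!quot_classM mulrDl quot_classD.
Qed.

HB.instance Definition _ (L : fieldType) (r : nat) (F : {fset {mpoly L[r]}}) :=
  GRing.Zmodule_isComPzRing.Build (quot_ring F)
    (@quot_mulA L r F) (@quot_mulC L r F) (@quot_mul1 L r F)
    (@quot_mulDl L r F).

Lemma quot_class_monoid_morphism (L : fieldType) (r : nat)
  (F : {fset {mpoly L[r]}}) : monoid_morphism (quot_class F).
Proof. by split=> // p q; apply: quot_classM. Qed.

HB.instance Definition _ (L : fieldType) (r : nat) (F : {fset {mpoly L[r]}}) :=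
  GRing.isZmodMorphism.Build {mpoly L[r]} (quot_ring F) (quot_class F)
    (@quot_classB L r F).

HB.instance Definition _ (L : fieldType) (r : nat) (F : {fset {mpoly L[r]}}) :=
  GRing.isMonoidMorphism.Build {mpoly L[r]} (quot_ring F) (quot_class F)
    (quot_class_monoid_morphism F).

(* The structure map of R = L[T_1, ..., T_r] / <F> over L. *)
Definition quot_scalar (L : fieldType) (r : nat) (F : {fset {mpoly L[r]}}) :
    {rmorphism L -> quot_ring F} :=
  quot_class F \o @mpolyC r L.

(* The value at a of p : {poly L}, where phi : L -> A. The library's
   (map_poly phi p).[a] needs A to be a nonzero ring. *)
Definition eval_over (L : fieldType) (A : comPzRingType)
    (phi : {rmorphism L -> A}) (p : {poly L}) (a : A) : A :=
  \sum_(i < size p) phi p`_i * a ^+ i.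

Definition integral_extension (L : fieldType) (A : comPzRingType)
    (phi : {rmorphism L -> A}) : Prop :=
  injective phi /\
  forall a : A, exists2 p : {poly L}, p \is monic & eval_over phi p a = 0.

Definition is_minimal_polynomial (L : fieldType) (A : comPzRingType)
    (phi : {rmorphism L -> A}) (a : A) (p : {poly L}) : Prop :=
  [/\ p \is monic, eval_over phi p a = 0
    & forall q : {poly L}, q \is monic -> eval_over phi q a = 0 ->
        (size p <= size q)%N].

Definition monomial (L : fieldType) (p : {poly L}) : Prop :=
  exists n : nat, p = 'X^n.

(* Main.v *)
Require Import Defs.
From HB Require Import structures.
From mathcomp Require Import all_boot all_order all_algebra.
From mathcomp Require Import generic_quotient ring_quotient finmap.
From mathcomp Require Import boolp mpoly.
From mathcomp Require Import qpoly zify.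

Set Implicit Arguments.
Unset Strict Implicit.
Unset Printing Implicit Defensive.

Import GRing.Theory.

Local Open Scope ring_scope.

(** Write I for the ideal generated by the system F in L[T_1, ..., T_r]. The
    argument has three parts: I is proper, R is integral over L, and
    non-nilpotency of the class of g modulo I produces a zero of F where g
    does not vanish.

    Properness: adjoining roots of the monic f_r, f_(r-1), ..., f_1 one after
    the other, by passing from a nonzero ring B to B[X]/(f_i), produces a
    nonzero L-algebra in which F has a common zero [common_zero_in_ring].
    Hence no nonzero constant lies in I, and L embeds in R.

    Integrality: f_i is an equation of integral dependence for T_i over the
    subring generated by T_(i+1), ..., T_r, so by transitivity every T_i, and
    hence every element of R, is integral over L [integral_mod_system]. The
    polynomials annihilating the class of g therefore form a nonzero ideal of
    L[X], and its monic generator is the minimal polynomial.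

    Zeros: if p_g = X^n, then g^n lies in I and g vanishes on V(F). If p_g is
    not a monomial, it does not divide any X^n, so no power of g lies in I.
    Membership in I amounts to solving a finite linear system over L, which
    has a solution over L as soon as it has one over a larger field; so no
    power of g lies in the extension I' of I to Lbar[T] either
    [ideal_descent]. Thus the saturation J of I' with respect to g is proper.
    If t satisfies a monic equation over Lbar modulo a proper ideal, then that
    ideal contains a product of factors t - a. They cannot all be invertible
    modulo the ideal, so some t - a can be adjoined to it leaving it proper
    [specialize_one]. Applied to J and g, with the powers of X
    removed from the equation of g because powers of g can be cancelled modulo
    J, this gives a value a <> 0 of g; applied to T_1, ..., T_r in turn it
    gives coordinates x_i. Modulo the proper ideal obtained every polynomial
    is congruent to its value at x, so F vanishes at x and g(x) = a <> 0
    [solution_of_not_nilpotent]. *)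

(** * Evaluation of multivariate polynomials in a ring *)

Lemma rmorph_mmap (R A B : comNzRingType) (r : nat) (g : {rmorphism A -> B})
    (phi : R -> A) (x : 'I_r -> A) (p : {mpoly R[r]}) :
  g (mmap phi x p) = mmap (g \o phi) (g \o x) p.
Proof.
rewrite rmorph_sum; apply: eq_bigr => m _; rewrite rmorphM rmorph_prod.
by congr (_ * _); apply: eq_bigr => j _; rewrite rmorphXn.
Qed.

Lemma mpoly_mmap (R : comNzRingType) (r : nat) (p : {mpoly R[r]}) :
  p = mmap (@mpolyC r R) (fun j => 'X_j) p.
Proof.
rewrite {1}[p]mpolyE; apply: eq_bigr => m _.
by rewrite -mul_mpolyC mpolyXE_id.
Qed.

Lemma eq_mmap_occurs (L : fieldType) (A : comNzRingType) (r : nat)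
    (phi : L -> A) (x y : 'I_r -> A) (f : {mpoly L[r]}) :
  (forall j, occurs_in f j -> x j = y j) -> mmap phi x f = mmap phi y f.
Proof.
move=> exy; apply: eq_big_seq => m fm; congr (_ * _).
apply: eq_bigr => j _; have [->|mj] := eqVneq (m j) 0%N; first by [].
by rewrite exy //; apply/hasP; exists m.
Qed.

Lemma rpred_mmap (L : fieldType) (A : comNzRingType) (C : subringClosed A)
    (r : nat) (phi : L -> A) (x : 'I_r -> A) (f : {mpoly L[r]}) :
  (forall c, phi c \in C) -> (forall j, occurs_in f j -> x j \in C) ->
  mmap phi x f \in C.
Proof.
move=> Cphi Cx; rewrite /mmap big_seq; apply: rpred_sum => m fm.
apply/rpredM/rpred_prod => // j _.
have [->|mj] := eqVneq (m j) 0%N; first exact: rpred1.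
by apply/rpredX/Cx/hasP; exists m.
Qed.

(** * A polynomial as a univariate polynomial in its main variable *)

Lemma occurs_in_kidx (L : fieldType) (r : nat) (f : {mpoly L[r]}) (j : 'I_r) :
  occurs_in f j -> (kidx f <= j.+1)%N.
Proof.
move=> fj; rewrite ltnS leqNgt; apply/negP => ltj.
by have := before_find j ltj; rewrite nth_ord_enum fj.
Qed.

(** The coefficient map of [upoly] in the form of a composite, which exhibits it
    as a ring morphism. *)
Lemma upolyE (L : fieldType) (r : nat) (i : nat) (f : {mpoly L[r]}) :
  upoly i f = mmap (polyC \o @mpolyC r L)
       (fun j : 'I_r => if j.+1 == i then 'X else ('X_j)%:P) f.
Proof. by []. Qed.

Lemma horner_map_upoly (L : fieldType) (A : comNzRingType) (r i : nat)
    (h : {rmorphism {mpoly L[r]} -> A}) (a : A) (f : {mpoly L[r]}) :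
  (map_poly h (upoly i f)).[a] =
  mmap (h \o @mpolyC r L) (fun j => if j.+1 == i then a else h 'X_j) f.
Proof.
rewrite upolyE -[LHS]/((horner_eval a \o map_poly h) _) rmorph_mmap.
apply: eq_bigr => m _; congr (_ * _).
  by rewrite /= map_polyC /horner_eval hornerC.
apply: eq_bigr => j _; congr (_ ^+ _); rewrite /= /horner_eval.
by case: ifP => _; rewrite ?map_polyX ?hornerX // map_polyC hornerC.
Qed.

Lemma upoly_hornerX (L : fieldType) (r : nat) (i : 'I_r) (f : {mpoly L[r]}) :
  (upoly i.+1 f).['X_i] = f.
Proof.
have := horner_map_upoly i.+1 idfun 'X_i f; rewrite map_poly_id // => ->.
rewrite [RHS]mpoly_mmap.
apply: eq_bigr => m _; congr (_ * _); apply: eq_bigr => j _; congr (_ ^+ _).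
by case: eqP => // -[/val_inj ->].
Qed.

(** * Common zeros of a monic triangular system in a ring extension *)

(** The class of X is the universal root of p, so its values are residues. *)
Lemma horner_qpolyX (A : comNzRingType) (p q : {poly A}) :
  (map_poly (qpolyC p) q).[qpolyX p] = in_qpoly p q.
Proof.
have -> : map_poly (qpolyC p) q = map_poly (in_qpoly p) (q^:P).
  rewrite -map_poly_comp; apply: eq_map_poly => c /=; apply: val_inj => /=.
  by rewrite Pdiv.CommonRing.rmodp_small ?size_polyC //;
     apply: leq_ltn_trans (leq_b1 _) (size_mk_monic_gt1 _).
by rewrite horner_map -[_.['X]]/(q \Po 'X) comp_polyXr.
Qed.

Lemma in_qpoly_self (A : comNzRingType) (p : {poly A}) :
  p \is monic -> (1 < size p)%N -> in_qpoly p p = 0.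
Proof.
move=> mp sp; apply: val_inj; rewrite /= /mk_monic sp mp /=.
exact: (Pdiv.RingMonic.rmodpp mp).
Qed.

Lemma uniq_map_injective (T1 T2 : eqType) (k : T1 -> T2) (s : seq T1) :
  uniq [seq k x | x <- s] -> {in s &, injective k}.
Proof.
elim: s => //= a s IH /andP[/mapP na /IH inj] x y.
rewrite !inE => /predU1P[->|xs] /predU1P[->|ys] // e; last exact: inj.
  by case: na; exists y.
by case: na; exists x.
Qed.

Section TriangularSystem.

Variables (L : fieldType) (r : nat) (S : triangular_system L r).

Lemma kidx_inj : {in tsF S &, injective (@kidx L r)}.
Proof.
case: S => F k g /= _ _ [fs efs sfs] _ _ f1 f2; rewrite -!efs => f1s f2s e.
exact: (uniq_map_injective (sorted_uniq ltn_trans ltnn sfs)).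
Qed.

Lemma kidx_bounds f : f \in tsF S -> (1 <= kidx f <= r)%N.
Proof.
case: S => F k g kr h1 h2 h3 H fF; have /andP[k0 kk] := H f fF.
by apply/andP; split=> //; apply: leq_trans kk kr.
Qed.

Lemma tsF_nonconstant f : f \in tsF S -> nonconstant f.
Proof. by case: S => F k g /= _ H _ _ _; apply: H. Qed.

Hypothesis Smonic : monic_system S.

Lemma upoly_monic f : f \in tsF S -> upoly (kidx f) f \is monic.
Proof. by move=> fS; apply/monicP; apply: Smonic. Qed.

(** Otherwise f, being monic in its main variable, would be the constant 1. *)
Lemma size_upoly f : f \in tsF S -> (1 < size (upoly (kidx f) f))%N.
Proof.
move=> fS; rewrite ltnNge; apply/negP => sz.
have /andP[k0 kr] := kidx_bounds fS.
have kP : ((kidx f).-1 < r)%N by rewrite prednK.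
have u1 : upoly (kidx f) f = 1.
  have := upoly_monic fS; rewrite [X in X \is _](size1_polyC sz) monicE.
  by rewrite [in X in _ -> X](size1_polyC sz) lead_coefC => /eqP ->.
apply: (tsF_nonconstant fS (c := 1)).
rewrite -(upoly_hornerX (Ordinal kP) f).
by rewrite -[(Ordinal kP).+1]/(kidx f) u1 hornerC mpolyC1.
Qed.

(** The coordinates are found from T_r down to T_1: once the f with main
    variable beyond T_i vanish, specializing the later variables turns f_i into
    a monic polynomial over the ring built so far, and its root in the next
    quotient is the coordinate T_i. The coordinates not yet found may be
    arbitrary, as their variables do not occur in these f. *)
Lemma common_zero_in_ring :
  exists (B : comNzRingType) (iota : {rmorphism L -> B}) (x : 'I_r -> B),
    forall f, f \in tsF S -> mmap iota x f = 0.
Proof.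
suff /(_ r) [B [iota [x xP]]] : forall k,
    exists (B : comNzRingType) (iota : {rmorphism L -> B}) (x : 'I_r -> B),
    forall f, f \in tsF S -> (r - k < kidx f)%N -> mmap iota x f = 0.
  exists B, iota, x => f fS; apply: xP => //.
  by rewrite subnn; have /andP[] := kidx_bounds fS.
elim=> [|k [B [iota [x xP]]]].
  exists L, idfun, (fun _ => 0) => f /kidx_bounds/andP[_ fr].
  by rewrite subn0 ltnNge fr.
set i := (r - k)%N in xP.
have [/hasP[f0 f0S /eqP k0]|/hasPn nof] :=
    boolP (has (fun f => kidx f == i) (tsF S)); last first.
  exists B, iota, x => f fS lef; apply: xP => //.
  rewrite ltn_neqAle eq_sym nof // /i.
  by move: (kidx f) lef => n; lia.
pose p := map_poly (mmap iota x) (upoly i f0).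
have mp : p \is monic by rewrite monic_map // /= -k0 upoly_monic.
have sp : (1 < size p)%N.
  rewrite size_map_poly_id0 ?k0 -?k0 ?size_upoly //.
  by rewrite (monicP (upoly_monic f0S)) rmorph1 oner_neq0.
(* As p is monic of positive degree, this is the quotient by p itself and not by
   the default modulus X. *)
exists {poly %/ p}, (qpolyC p \o iota).
exists (fun j : 'I_r => if j.+1 == i then qpolyX p else qpolyC p (x j)).
move=> f fS lef.
have [fi|nfi] := eqVneq (kidx f) i.
  have -> : f = f0 by apply: kidx_inj; rewrite // k0.
  rewrite -[RHS](in_qpoly_self mp sp) -horner_qpolyX /p -map_poly_comp.
  rewrite (horner_map_upoly _ (qpolyC p \o mmap iota x)).
  apply: eq_bigr => m _; congr (_ * _); first by rewrite /= mmapC.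
  by apply: eq_bigr => j _; rewrite /= mmapX mmap1U.
have {lef nfi} ltf : (i < kidx f)%N.
  by rewrite ltn_neqAle eq_sym nfi /i; move: (kidx f) lef => n; lia.
have := congr1 (qpolyC p) (xP f fS ltf); rewrite rmorph0 => <-.
rewrite rmorph_mmap; apply: eq_mmap_occurs.
move=> j /occurs_in_kidx fj; case: eqP => // ji.
by move: ltf; rewrite -ji ltnNge fj.
Qed.

End TriangularSystem.

(** * Integrality modulo a dense monic system *)

Section IntegralClosure.

Variables (R A : comNzRingType) (phi : {rmorphism R -> A}).

Definition integral_closure : {pred A} := fun a => `[< integralOver phi a >].

Lemma integral_closureP a :
  reflect (integralOver phi a) (a \in integral_closure).
Proof. exact: asboolP. Qed.

Lemma integral_closure_subring_closed : subring_closed integral_closure.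
Proof.
split; first exact/integral_closureP/integral1.
- move=> a b /integral_closureP ia /integral_closureP ib.
  exact/integral_closureP/integral_sub.
move=> a b /integral_closureP ia /integral_closureP ib.
exact/integral_closureP/integral_mul.
Qed.

HB.instance Definition _ :=
  GRing.isSubringClosed.Build A integral_closure
    integral_closure_subring_closed.

End IntegralClosure.

Section Quotient.

Variables (L : fieldType) (r : nat) (F : {fset {mpoly L[r]}}).

Lemma mem_gen_ideal f : f \in F -> f \in gen_ideal F.
Proof.
move=> fS; apply/asboolP; exists (fun h => (h == f)%:R).
rewrite (big_fsetD1 f) //= eqxx mul1r big1_fset ?addr0 // => h.
by rewrite !inE => /andP[/negPf -> _]; rewrite mul0r.
Qed.

Lemma quot_class_eq0 p : quot_class F p = 0 <-> p \in gen_ideal F.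
Proof. by rewrite -[p in p \in _]subr0 quot_class_eq rmorph0. Qed.

Lemma eval_over_class a (p : {poly L}) :
  eval_over (quot_scalar F) p (quot_class F a) =
  quot_class F (map_poly (@mpolyC r L) p).[a].
Proof.
rewrite horner_coef size_map_poly rmorph_sum; apply: eq_bigr => i _.
by rewrite rmorphM rmorphXn coef_map.
Qed.

(** The value is taken in the polynomial ring and not in the quotient, because
    Horner evaluation is for nonzero rings and the quotient may be zero. *)
Definition annihilator (a : {mpoly L[r]}) (p : {poly L}) : Prop :=
  (map_poly (@mpolyC r L) p).[a] \in gen_ideal F.

Lemma eval_over_eq0 a p :
  eval_over (quot_scalar F) p (quot_class F a) = 0 <-> annihilator a p.
Proof. by rewrite eval_over_class quot_class_eq0. Qed.

End Quotient.

Section DenseSystem.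

Variables (L : fieldType) (r : nat) (S : triangular_system L r).
Hypothesis Smonic : monic_system S.
Hypothesis Sdense : dense_system S.

(** Downward induction on the index of a variable: the coefficients of f_j as a
    polynomial in T_j only involve later variables, which are integral already,
    so f_j is an equation of integral dependence for T_j. *)
Lemma integral_mod_system (A : comNzRingType)
    (q : {rmorphism {mpoly L[r]} -> A}) :
  (forall f, f \in tsF S -> q f = 0) ->
  forall p, integralOver (q \o @mpolyC r L) (q p).
Proof.
set phi := q \o _ => qF p; set C := integral_closure phi.
have Cphi c : phi c \in C by apply/integral_closureP/integral_id.
apply/integral_closureP; rewrite [p]mpoly_mmap rmorph_mmap.
apply: rpred_mmap => // j _ /=.
have [n] := ubnP (r - j); elim: n j => // n IH j /ltnSE le_n.
have /Sdense[f fS fj] : (1 <= j.+1 <= r)%N by rewrite ltn_ord.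
apply/integral_closureP.
apply: (@integral_root_monic _ _ _ _ (map_poly q (upoly (kidx f) f))).
- by rewrite monic_map // (upoly_monic Smonic fS).
- by apply/rootP; rewrite fj horner_map upoly_hornerX qF.
apply/integral_poly => k; apply/integral_closureP; move: k; apply/polyOverP.
rewrite upolyE rmorph_mmap; apply: rpred_mmap => [c|i fi] /=.
  by rewrite map_polyC polyOverC; apply: Cphi.
case: eqP => [_|ij]; first by rewrite map_polyX polyOverX.
rewrite map_polyC polyOverC; apply: IH.
have := occurs_in_kidx fi; rewrite fj in ij *.
by have := ltn_ord i; lia.
Qed.

(** A constant in the ideal vanishes in the nonzero ring where F has a common
    zero, and L embeds in that ring. *)
Lemma quot_scalar_inj : injective (quot_scalar (tsF S)).
Proof.
have [B [iota [x xP]]] := common_zero_in_ring Smonic.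
move=> a b /quot_class_eq; rewrite -mpolyCB => /asboolP[q eq].
apply/eqP; rewrite -subr_eq0 -(fmorph_eq0 iota) -(mmapC x iota) eq.
rewrite rmorph_sum /=.
rewrite big_seq big1 // => f fS; rewrite rmorphM /=.
by rewrite [X in _ * X]xP // mulr0.
Qed.

Lemma quot_integral a :
  exists2 p : {poly L}, p \is monic & annihilator (tsF S) a p.
Proof.
have n1 : (1 : quot_ring (tsF S)) != 0.
  apply/eqP => /= e; have /eqP := oner_neq0 L; apply; apply: quot_scalar_inj.
  by rewrite rmorph0 rmorph1.
(* The quotient as a nonzero ring, where integral dependence is defined. *)
pose A : comNzRingType := HB.pack (quot_ring (tsF S))
  (GRing.PzSemiRing_isNonZero.Build (quot_ring (tsF S)) n1).
pose q : {rmorphism {mpoly L[r]} -> A} := quot_class (tsF S).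
have [f /mem_gen_ideal/quot_class_eq0|p mp /rootP] // :=
  integral_mod_system (q := q) _ a.
by rewrite map_poly_comp horner_map => /quot_class_eq0; exists p.
Qed.

Lemma integral_quot : integral_extension (quot_scalar (tsF S)).
Proof.
split; first exact: quot_scalar_inj.
move=> a; have [b ->] := quot_class_surj a.
have [p mp pb] := quot_integral b; exists p => //.
exact/eval_over_eq0.
Qed.

End DenseSystem.

(** * Descent of ideal membership along a field extension *)

(** Solvability is a statement on ranks, and ranks do not change under a field
    extension. *)
Lemma linear_system_descent (L E : fieldType) (iota : {rmorphism L -> E})
    (I J : finType) (M : I -> J -> L) (b : J -> L) (c : I -> E) :
  (forall j, \sum_i c i * iota (M i j) = iota (b j)) ->
  exists c' : I -> L, forall j, \sum_i c' i * M i j = b j.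
Proof.
move=> cP; pose Mx := \matrix_(i < #|I|, j < #|J|) M (enum_val i) (enum_val j).
pose bx := \row_(j < #|J|) b (enum_val j).
have : (map_mx iota bx <= map_mx iota Mx)%MS.
  apply/submxP; exists (\row_i c (enum_val i)); apply/rowP => j.
  rewrite !mxE -cP (reindex _ (onW_bij _ (@enum_val_bij I))) /=.
  by apply: eq_bigr => i _; rewrite !mxE.
rewrite map_submx => /submxP[D /rowP DP].
exists (fun i => D 0 (enum_rank i)) => j.
have := DP (enum_rank j); rewrite !mxE enum_rankK => ->.
rewrite (reindex _ (onW_bij _ (@enum_val_bij I))) /=.
by apply: eq_bigr => i _; rewrite !mxE enum_valK enum_rankK.
Qed.

Lemma mpoly_span_descent (L E : fieldType) (iota : {rmorphism L -> E}) (r : nat)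
    (I : finType) (G : I -> {mpoly L[r]}) (p : {mpoly L[r]}) (c : I -> E) :
  map_mpoly iota p = \sum_i c i *: map_mpoly iota (G i) ->
  exists c' : I -> L, p = \sum_i c' i *: G i.
Proof.
move=> pE; pose k := maxn (msize p) (\max_i msize (G i)).
pose M i (m : 'X_{1..r < k}) := (G i)@_m.
have [m|c' c'P] := @linear_system_descent L E iota I _ M (fun m => p@_m) c.
  rewrite -mcoeff_map_mpoly pE raddf_sum; apply: eq_bigr => i _.
  by rewrite /= mcoeffZ mcoeff_map_mpoly.
exists c'; apply/mpolyP => m; rewrite raddf_sum.
have [km|mk] := leqP k (mdeg m).
  rewrite memN_msupp_eq0; last first.
    by apply: contraL km => /msize_mdeg_lt lt; rewrite -ltnNge leq_max lt.
  rewrite big1 // => i _; rewrite /= mcoeffZ memN_msupp_eq0 ?mulr0 //.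
  apply: contraL km => /msize_mdeg_lt lt; rewrite -ltnNge leq_max.
  by apply/orP; right; apply: leq_trans lt (leq_bigmax i).
rewrite -[m]/(bmnm (BMultinom mk)) -c'P; apply: eq_bigr => i _.
by rewrite /= mcoeffZ.
Qed.

(** The multipliers are indexed by F itself and not by its image, so that a
    representation over L and one over E have the same shape. *)
Definition extended_ideal (L E : fieldType) (iota : L -> E) (r : nat)
    (F : {fset {mpoly L[r]}}) (u : {mpoly E[r]}) : Prop :=
  exists q : {mpoly L[r]} -> {mpoly E[r]},
    u = \sum_(f <- F) q f * map_mpoly iota f.

(** The multipliers have bounded degree, so that the element is a linear
    combination of the finitely many products of a monomial with some f. *)
Lemma ideal_descent (L E : fieldType) (iota : {rmorphism L -> E}) (r : nat)
    (F : {fset {mpoly L[r]}}) (p : {mpoly L[r]}) :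
  extended_ideal iota F (map_mpoly iota p) -> p \in gen_ideal F.
Proof.
move=> [q pE]; pose d := \max_(f : F) msize (q (val f)).
pose G (i : F * 'X_{1..r < d}) := 'X_[i.2] * val i.1.
pose a (i : F * 'X_{1..r < d}) := (q (val i.1))@_i.2.
have [|c cP] := @mpoly_span_descent _ _ iota _ _ G p a.
  rewrite pE big_seq_fsetE /= -(pair_bigA _ (fun (f : F) (m : 'X_{1..r < d}) =>
    a (f, m) *: map_mpoly iota (G (f, m)))).
  apply: eq_bigr => f _; rewrite {1}(@mpolywE _ _ d (q (val f))); last first.
    exact: (leq_bigmax f).
  rewrite mulr_suml; apply: eq_bigr => m _.
  by rewrite rmorphM /= map_mpolyX scalerAl.
apply/asboolP; exists (fun f =>
  \sum_m oapp (fun f' : F => c (f', m)) 0 (insub f) *: 'X_[m]).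
rewrite cP big_seq_fsetE /=.
rewrite (eq_bigr (fun i => c (i.1, i.2) *: G (i.1, i.2))); last by case.
rewrite -(pair_bigA _ (fun (f : F) (m : 'X_{1..r < d}) =>
  c (f, m) *: G (f, m))).
apply: eq_bigr => f _; rewrite mulr_suml; apply: eq_bigr => m _.
by rewrite valK /= scalerAl.
Qed.

(** * Adjoining elements to a proper ideal *)

Section Ideals.

Variable A : comNzRingType.

Record ideal_of (J : A -> Prop) : Prop := IdealOf {
  ideal0 : J 0;
  idealD : forall a b, J a -> J b -> J (a + b);
  idealMl : forall c a, J a -> J (c * a) }.

Definition adjoin (J : A -> Prop) (t : A) : A -> Prop :=
  fun u => exists v w, J v /\ u = v + w * t.

Definition saturation (J : A -> Prop) (g : A) : A -> Prop :=
  fun u => exists n, J (g ^+ n * u).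

Lemma adjoin_ideal J t : ideal_of J -> ideal_of (adjoin J t).
Proof.
move=> [J0 JD JM]; split.
- by exists 0, 0; rewrite mul0r addr0.
- move=> a b [v [w [Jv ->]]] [v' [w' [Jv' ->]]].
  by exists (v + v'), (w + w'); rewrite mulrDl addrACA; split=> //; apply: JD.
move=> c a [v [w [Jv ->]]]; exists (c * v), (c * w).
by rewrite mulrDr mulrA; split=> //; apply: JM.
Qed.

Lemma adjoin_sub (J : A -> Prop) t u : J u -> adjoin J t u.
Proof. by move=> Ju; exists u, 0; rewrite mul0r addr0. Qed.

Lemma adjoin_mem J t : ideal_of J -> adjoin J t t.
Proof. by move=> [J0 _ _]; exists 0, 1; rewrite mul1r add0r. Qed.

Lemma saturation_ideal J g : ideal_of J -> ideal_of (saturation J g).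
Proof.
move=> [J0 JD JM]; split.
- by exists 0%N; rewrite mulr0.
- move=> a b [n Ja] [m Jb]; exists (n + m)%N; rewrite mulrDr {1}addnC !exprD.
  by rewrite -!mulrA; apply: JD; apply: JM.
by move=> c a [n Ja]; exists n; rewrite mulrCA; apply: JM.
Qed.

(** If every factor were invertible modulo J, then so would be their product,
    and J would be the unit ideal. *)
Lemma proper_adjoin_factor J (cs : seq A) :
  ideal_of J -> ~ J 1 -> J (\prod_(c <- cs) c) ->
  exists2 c, c \in cs & ~ adjoin J c 1.
Proof.
move=> [J0 JD JM] J1 Jcs; apply: contrapT => nocs; apply: J1.
have {nocs} unit_cs c : c \in cs -> adjoin J c 1.
  by move=> ccs; apply: contrapT => nc; apply: nocs; exists c.
suff /(_ 1) : forall u, J (u * \prod_(c <- cs) c) -> J u.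
  by rewrite mul1r; apply.
elim: cs {Jcs} unit_cs => [_ u|c cs IH unit_cs u].
  by rewrite big_nil mulr1.
rewrite big_cons mulrA => /IH Juc.
have [v [w [Jv e]]] := unit_cs c (mem_head _ _).
rewrite -[u]mulr1 e mulrDr mulrCA; apply: JD; first exact: JM.
by apply/JM/Juc => c' c'cs; apply: unit_cs; rewrite inE c'cs orbT.
Qed.

End Ideals.

Section Specialization.

Variables (E : closedFieldType) (r : nat).
Implicit Types (J : {mpoly E[r]} -> Prop) (t : {mpoly E[r]}).

(** Over an algebraically closed field P(t) is a product of factors t - a, and
    one of these can be adjoined by [proper_adjoin_factor]. *)
Lemma specialize_one J t (P : {poly E}) :
  ideal_of J -> ~ J 1 -> P \is monic -> J (map_poly (@mpolyC r E) P).[t] ->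
  exists2 a, root P a & ~ adjoin J (t - a%:MP) 1.
Proof.
move=> iJ J1 mP; have [s sE] := closed_field_poly_normal P.
rewrite (monicP mP) scale1r in sE.
rewrite sE rmorph_prod horner_prod => Js.
have [|c] := @proper_adjoin_factor _ J [seq t - a%:MP | a <- s] iJ J1.
  rewrite big_map; move: Js; congr (J _); apply: eq_bigr => a _.
  by rewrite /= map_polyXsubC hornerXsubC.
by case/mapP => a sa -> ?; exists a; rewrite ?root_prod_XsubC.
Qed.

(** The equations of the remaining elements persist in a larger ideal, so the
    elements can be specialized one after the other. *)
Lemma specialize_all J (ts : seq {mpoly E[r]}) :
  ideal_of J -> ~ J 1 ->
  (forall t, t \in ts ->
     exists2 P : {poly E}, P \is monic & J (map_poly (@mpolyC r E) P).[t]) ->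
  exists J' : {mpoly E[r]} -> Prop,
    [/\ ideal_of J', ~ J' 1, forall u, J u -> J' u &
        forall t, t \in ts -> exists a : E, J' (t - a%:MP)].
Proof.
elim: ts J => [|t ts IH] J iJ J1 its; first by exists J; split.
have [P mP JP] := its t (mem_head _ _).
have [a _ aJ] := specialize_one iJ J1 mP JP.
have [|J' [iJ' J'1 JJ' J'ts]] := IH _ (adjoin_ideal (t - a%:MP) iJ) aJ.
  move=> t' t'ts; have [|Q mQ JQ] := its t'; first by rewrite inE t'ts orbT.
  by exists Q => //; apply: adjoin_sub.
exists J'; split=> // [u Ju|t']; first exact/JJ'/adjoin_sub.
rewrite inE => /predU1P[->|]; last exact: J'ts.
by exists a; apply/JJ'/adjoin_mem.
Qed.

(** Congruence to a constant modulo J is compatible with sums and products. *)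
Lemma ideal_eval J (x : 'I_r -> E) (p : {mpoly E[r]}) :
  ideal_of J -> (forall j, J ('X_j - (x j)%:MP)) -> J (p - (p.@[x])%:MP).
Proof.
move=> [J0 JD JM] Jx.
pose R u (a : E) := J (u - a%:MP).
have R1 : R 1 1 by rewrite /R mpolyC1 subrr.
have RM u a v b : R u a -> R v b -> R (u * v) (a * b).
  rewrite /R mpolyCM => Ju Jv.
  rewrite (_ : _ - _ = v * (u - a%:MP) + a%:MP * (v - b%:MP)).
    by apply: JD; apply: JM.
  by rewrite !mulrBr addrA [v * u]mulrC [v * a%:MP]mulrC subrK.
rewrite {1}[p]mpoly_mmap; apply: (big_ind2 R).
- by rewrite /R mpolyC0 subrr.
- by move=> u a v b; rewrite /R mpolyCD opprD addrACA; apply: JD.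
move=> m _; apply: (RM); first by rewrite /R subrr.
apply: (big_ind2 R R1 RM) => j _; elim: (m j) => // n IH.
by rewrite !exprS; apply: RM.
Qed.

End Specialization.

Lemma proper_ideal_const (E : fieldType) (r : nat)
    (J : {mpoly E[r]} -> Prop) c :
  ideal_of J -> ~ J 1 -> J c%:MP -> c = 0.
Proof.
move=> [_ _ JM] J1 Jc; apply: contra_notP J1 => /eqP c0.
by rewrite -mpolyC1 -(mulVf c0) mpolyCM; apply: JM.
Qed.

Lemma extended_ideal_of (L E : fieldType) (iota : L -> E) (r : nat)
    (F : {fset {mpoly L[r]}}) : ideal_of (extended_ideal iota F).
Proof.
split.
- by exists (fun _ => 0); rewrite big1 // => f _; rewrite mul0r.
- move=> _ _ [q1 ->] [q2 ->]; exists (fun f => q1 f + q2 f).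
  by rewrite -big_split; apply: eq_bigr => f _; rewrite mulrDl.
move=> c _ [q ->]; exists (fun f => c * q f).
by rewrite mulr_sumr; apply: eq_bigr => f _; rewrite mulrA.
Qed.

Lemma map_gen_ideal (L E : fieldType) (iota : {rmorphism L -> E}) (r : nat)
    (F : {fset {mpoly L[r]}}) p :
  p \in gen_ideal F -> extended_ideal iota F (map_mpoly iota p).
Proof.
move=> /asboolP[q ->]; exists (fun f => map_mpoly iota (q f)).
by rewrite rmorph_sum; apply: eq_bigr => f _; rewrite rmorphM.
Qed.

(** * The minimal polynomial as generator of an ideal *)

Section Annihilator.

Variables (L : fieldType) (N : {poly L} -> Prop).
Hypothesis iN : ideal_of N.

Definition least_monic (p : {poly L}) :=
  [/\ p \is monic, N p & forall q, q \is monic -> N q -> (size p <= size q)%N].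

Lemma least_monic_dvdp p q : least_monic p -> N q -> p %| q.
Proof.
case: iN => N0 ND NM [mp Np minp] Nq; rewrite /dvdp; apply: contraT => nz.
have Nr : N (q %% p).
  rewrite -[_ %% _](addKr (q %/ p * p)) -divp_eq addrC -mulNr; apply: ND => //.
  exact: NM.
(* A nonzero remainder, made monic, would be smaller than p. *)
have mr : (lead_coef (q %% p))^-1 *: (q %% p) \is monic.
  by rewrite monicE lead_coefZ mulVf // lead_coef_eq0.
have := minp _ mr; rewrite size_scale ?invr_eq0 ?lead_coef_eq0 //.
rewrite leqNgt ltn_modpN0 ?monic_neq0 //; apply.
by rewrite -mul_polyC; apply: NM.
Qed.

Lemma least_monic_exists p : p \is monic -> N p -> exists! q, least_monic q.
Proof.
move=> mp Np.
pose good n := `[< exists q, [/\ q \is monic, N q & size q = n] >].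
have exg : exists n, good n by exists (size p); apply/asboolP; exists p.
have [n /asboolP[q [mq Nq qn]] minn] := ex_minnP exg.
have lq : least_monic q.
  by split=> // q' mq' Nq'; rewrite qn; apply/minn/asboolP; exists q'.
exists q; split=> // q' lq'; have [[mq' Nq' _]] := lq'.
apply/eqP; rewrite -eqp_monic // /eqp.
by rewrite !least_monic_dvdp.
Qed.

End Annihilator.

Lemma annihilator_ideal (L : fieldType) (r : nat) (F : {fset {mpoly L[r]}}) a :
  ideal_of (annihilator F a).
Proof.
rewrite /annihilator; split=> [|p q|c p].
- by rewrite rmorph0 horner0 rpred0.
- by rewrite rmorphD hornerD; apply: rpredD.
by rewrite rmorphM hornerM; apply: gen_idealMr.
Qed.

Lemma minimal_polynomialP (L : fieldType) (r : nat)
    (F : {fset {mpoly L[r]}}) a p :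
  is_minimal_polynomial (quot_scalar F) (quot_class F a) p <->
  least_monic (annihilator F a) p.
Proof.
by split=> -[mp /eval_over_eq0 pg minp]; split=> // q mq /eval_over_eq0;
  apply: minp.
Qed.

(** * Solutions over an algebraically closed field *)

Section Solutions.

Variables (L : fieldType) (r : nat) (S : triangular_system L r).
Hypothesis Smonic : monic_system S.
Hypothesis Sdense : dense_system S.

(** The Nullstellensatz for F, in contrapositive form. The element g is
    specialized first, to a nonzero value, and then the variables, which gives
    the point. *)
Lemma solution_of_not_nilpotent (E : closedFieldType)
    (iota : {rmorphism L -> E}) :
  (forall n, tsg S ^+ n \notin gen_ideal (tsF S)) ->
  exists x : 'I_r -> E, solution iota S x.
Proof.
move=> ng; pose I := extended_ideal iota (tsF S).
pose g := map_mpoly iota (tsg S).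
have iI : ideal_of I by exact: extended_ideal_of.
have intI p : exists2 P : {poly E}, P \is monic &
    I (map_poly (@mpolyC r E) P).[map_mpoly iota p].
  have [P mP Pp] := quot_integral Smonic Sdense p.
  exists (map_poly iota P); first by rewrite monic_map.
  have -> : map_poly (@mpolyC r E) (map_poly iota P) =
      map_poly (map_mpoly iota) (map_poly (@mpolyC r L) P).
    by rewrite -!map_poly_comp; apply: eq_map_poly => c; rewrite /= map_mpolyC.
  by rewrite horner_map; apply: map_gen_ideal.
(* Powers of g may be cancelled modulo J. *)
pose J := saturation I g.
have iJ : ideal_of J by exact: saturation_ideal.
have J1 : ~ J 1.
  move=> [n]; rewrite mulr1 -rmorphXn => /ideal_descent.
  by apply/negP.
have IJ u : I u -> J u by move=> Iu; exists 0%N; rewrite mul1r.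
(* Only the factor Q prime to X of an equation P for g is needed modulo J, and
   its roots are nonzero. *)
have [P mP IP] := intI (tsg S); rewrite -/g in IP.
have [m [Q /implyP rQ PE]] := multiplicity_XsubC P 0.
rewrite polyC0 subr0 in PE.
have {}rQ := rQ (monic_neq0 mP).
have mQ : Q \is monic by move: mP; rewrite PE monicMr // monicXn.
have JQ : J (map_poly (@mpolyC r E) Q).[g].
  exists m; move: IP.
  by rewrite PE rmorphM /= map_polyXn hornerM hornerXn mulrC.
have [a Qa aJ] := specialize_one iJ J1 mQ JQ.
have a0 : a != 0 by apply: contraNneq rQ => <-.
have [|J' [iJ' J'1 JJ' J'X]] := @specialize_all E r (adjoin J (g - a%:MP))
   [seq 'X_j | j <- enum 'I_r] (adjoin_ideal _ iJ) aJ.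
  move=> _ /mapP[j _ ->]; have [R mR IR] := intI 'X_j; exists R => //.
  by apply/adjoin_sub/IJ; rewrite map_mpolyX in IR.
have [x xJ] : exists x : 'I_r -> E, forall j, J' ('X_j - (x j)%:MP).
  suff /boolp.choice[x xJ] : forall j, exists a : E, J' ('X_j - a%:MP).
    by exists x.
  by move=> j; apply: J'X; apply: map_f; rewrite mem_enum.
have J'c := proper_ideal_const iJ' J'1.
have J'B u v : J' u -> J' (u - v) -> J' v.
  move=> Ju Juv; rewrite -[v](subKr u) -mulN1r.
  by apply: (idealD iJ') => //; apply: (idealMl iJ').
exists x; split=> [f fS|gx].
  apply: J'c; apply: (J'B _ _ _ (ideal_eval _ iJ' xJ)).
  by apply/JJ'/adjoin_sub/IJ/map_gen_ideal/mem_gen_ideal.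
have := ideal_eval g iJ' xJ; rewrite gx mpolyC0 subr0 => J'g.
move/eqP: a0; apply; apply: J'c; apply: J'B J'g _.
exact/JJ'/adjoin_mem.
Qed.

End Solutions.

Theorem proposition3p8 (L : fieldType) (r : nat) (S : triangular_system L r)
    (Smonic : monic_system S) (Sdense : dense_system S) :
  let phi := quot_scalar (tsF S) in
  let gbar := quot_class (tsF S) (tsg S) in
  [/\ integral_extension phi,
      exists! pg : {poly L}, is_minimal_polynomial phi gbar pg
    & forall (Lbar : closedFieldType) (iota : {rmorphism L -> Lbar}),
        algebraic_closure iota ->
        forall pg : {poly L}, is_minimal_polynomial phi gbar pg ->
          (exists x : 'I_r -> Lbar, solution iota S x) <-> ~ monomial pg].
Proof.
move=> phi gbar; split; first exact: integral_quot.
  have [p mp pg] := quot_integral Smonic Sdense (tsg S).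
  have [q [/minimal_polynomialP lq uq]] :=
    least_monic_exists (annihilator_ideal _ _) mp pg.
  by exists q; split=> // q' /minimal_polynomialP; apply: uq.
move=> Lbar iota _ pg /minimal_polynomialP lpg; split.
  move=> [x [xF xg]] [n pgE]; case: lpg => _ + _.
  rewrite pgE /annihilator map_polyXn hornerXn => /(map_gen_ideal iota)[q qE].
  have /eqP : (map_mpoly iota (tsg S)).@[x] ^+ n = 0; last first.
    by rewrite expf_eq0 => /andP[_ /eqP].
  rewrite -!rmorphXn /= qE rmorph_sum big_seq big1 // => f fS /=.
  by rewrite mevalM xF ?mulr0.
move=> notmono; apply: (solution_of_not_nilpotent Smonic Sdense) => n.
apply/negP => gn; apply: notmono.
(* The monic divisors of X^n are monomials. *)
have /(least_monic_dvdp (annihilator_ideal _ _) lpg) :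
    annihilator (tsF S) (tsg S) 'X^n.
  by rewrite /annihilator map_polyXn hornerXn.
rewrite -['X]subr0 -polyC0 => /dvdp_exp_XsubCP[k _ pgk].
exists k; apply/eqP; rewrite -eqp_monic ?monicXn //; last by case: lpg.
by move: pgk; rewrite polyC0 subr0.
Qed.
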